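(* Let $\theta\in[0,1]$, $k\in\mathbb N$, $U_0\in\mathscr F^{sa}$ and $\alpha,\beta^i,\gamma^i:\mathscr F^{sa}\to\mathscr F^{sa}$ ($i=1,\dots,k$). Suppose there are constants $\bar L>0$ and $\bar K>0$ such that for all $U\in\mathscr F^{sa}$ $$\psi(U\alpha(U))+\frac k2\sum_{i=1}^k\|\beta^i(U)\|_2^2\,\|\gamma^i(U)\|_2^2\le-\bar L\|U\|_2^2,\qquad \|\alpha(U)\|_2^2\le\bar K\|U\|_2^2 .$$ For a step size $h>0$ let $\{\bar U_n\}_{n\ge0}\subset\mathscr F^{sa}$ be an adapted numerical solution given by the free stochastic theta method $$\bar U_{n+1}=\bar U_n+(1-\theta)\alpha(\bar U_n)h+\theta\alpha(\bar U_{n+1})h+\sum_{i=1}^k\beta^i(\bar U_n)\,\Delta W_n\,\gamma^i(\bar U_n),\qquad \bar U_0=U_0 .$$ Then: 1. If $\theta\in[0,1/2)$ and $\rho$ is such that $0<\rho<\frac{2\bar L}{(1-2\theta)\bar K}$, then for any given step size $0<h\le\rho$ there exists a constant $C>0$ such that for all $n\in\mathbb N$ $$\|\bar U_n\|_2^2\le e^{-Cnh}\,\|U_0-\theta h\,\alpha(U_0)\|_2^2 .$$ 2. If $\theta\in[1/2,1]$, then for any given step size $h>0$ there exists a constant $C'>0$ such that for all $n\in\mathbb N$ $$\|\bar U_n\|_2^2\le e^{-C'nh}\,\|U_0-\theta h\,\alpha(U_0)\|_2^2 .$$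
   Context: $(\mathscr F,\psi)$ is a non-commutative probability space: a von Neumann algebra $\mathscr F$ with a faithful unital normal trace $\psi$. $\mathscr F^{sa}$ is the set of self-adjoint elements, and $\|U\|_2=\psi(|U|^2)^{1/2}$ with $|U|=(U^*U)^{1/2}$. $\{W_t\}_{t\ge0}\subset\mathscr F^{sa}$ is a free Brownian motion: $W_0=0$; for $0\le s<t$ the increment $W_t-W_s$ is freely independent from $\mathscr W_s$, the von Neumann algebra generated by $\{W_\tau:0\le\tau\le s\}$; and $W_t-W_s$ has the semicircular distribution of mean $0$ and variance $t-s$. For step size $h>0$: $t_n=nh$, $\Delta W_n=W_{t_{n+1}}-W_{t_n}$. The numerical solution is adapted: $\bar U_n\in\mathscr W_{t_n}$ for all $n$. Convention on coefficients: $\alpha,\beta^i,\gamma^i$ map $\mathscr F^{sa}\cap\mathscr W_t$ into $\mathscr W_t$ for every $t$, and the noise sums $\sum_i\beta^i(\bar U_n)\Delta W_n\gamma^i(\bar U_n)$ are self-adjoint. *)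

(* Defs.v *)
From HB Require Import structures.
From mathcomp Require Import all_boot all_order all_algebra.
From mathcomp Require Import complex.
From mathcomp Require Import all_classical all_reals all_analysis.

Set Implicit Arguments.
Unset Strict Implicit.
Unset Printing Implicit Defensive.

Import Order.TTheory GRing.Theory Num.Theory.
Import numFieldNormedType.Exports.

#[global] Open Scope classical_set_scope.
#[global] Open Scope complex_scope.
#[global] Open Scope ring_scope.

(* Operators on the complex Hilbert space H are elements of H -> H, with the
   pointwise linear structure; their product is the composition \o.  A von
   Neumann algebra is a set of such operators, and the maps on it (a trace, the
   coefficients of an equation) are total on H -> H but only constrained there. *)

Section Operators.
Context {R : realType} {H : completeNormedModType R[i]}.
Variable dot : {dot H for (@Num.conj R[i])}.
Implicit Types (A B X : H -> H) (S F : set (H -> H)).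

(* Completeness is carried by the type of H. *)
Definition hilbert_inner_product := forall x : H, `|x| ^+ 2 = dot x x.

Definition bounded_operator A :=
  linear A /\ exists M : R[i], forall x, `|A x| <= M * `|x|.

Definition is_adjoint A B := forall x y, dot (A x) y = dot x (B y).

Definition star A : H -> H := xget 0 [set B | is_adjoint A B].

Definition le_op A B := forall x, 0 <= dot ((B - A) x) x.

Definition commutant S : set (H -> H) :=
  [set A | bounded_operator A /\ forall B, S B -> A \o B = B \o A].

Definition von_neumann_algebra S :=
  (forall A, S A -> exists2 B, S B & is_adjoint A B) /\
  commutant (commutant S) = S.

Definition generated_vna S : set (H -> H) := smallest von_neumann_algebra S.

Definition selfadjoint_part F : set (H -> H) := [set A | F A /\ is_adjoint A A].

Section Trace.
Variables (F : set (H -> H)) (psi : (H -> H) -> R[i]).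

Definition directed (D : set (H -> H)) :=
  D !=set0 /\ forall A B, D A -> D B -> exists E, [/\ D E, le_op A E & le_op B E].

Definition is_sup_in_sa (D : set (H -> H)) A :=
  [/\ selfadjoint_part F A, forall B, D B -> le_op B A
    & forall A', selfadjoint_part F A' -> (forall B, D B -> le_op B A') ->
        le_op A A'].

(* psi preserves suprema of bounded increasing families; psi B <= psi A for B
   in the family is automatic by positivity.  The order on R[i] is
   z <= w iff w - z is a nonnegative real. *)
Definition normal_functional :=
  forall (D : set (H -> H)) A,
    D `<=` selfadjoint_part F -> directed D -> is_sup_in_sa D A ->
    forall c : R[i], (forall B, D B -> psi B <= c) -> psi A <= c.

Record faithful_unital_normal_trace : Prop := {
  trace_linear : forall (c : R[i]) A B, F A -> F B ->
    psi (c *: A + B) = c * psi A + psi B;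
  trace_positive : forall A, F A -> 0 <= psi (star A \o A);
  trace_tracial : forall A B, F A -> F B -> psi (A \o B) = psi (B \o A);
  trace_faithful : forall A, F A -> psi (star A \o A) = 0 -> A = 0;
  trace_unital : psi idfun = 1;
  trace_normal : normal_functional }.

(* |U|^2 = U^* U since |U| is the square root of U^* U. *)
Definition norm2 A : R := Num.sqrt (complex.Re (psi (star A \o A))).

(* Words a_0 a_1 ... a_n with centred letters taken from subalgebras no two
   consecutive of which coincide have trace zero. *)
Definition freely_independent (I : Type) (S : I -> set (H -> H)) :=
  forall (n : nat) (i : nat -> I) (a : nat -> H -> H),
    (forall j, (j <= n)%N -> S (i j) (a j) /\ psi (a j) = 0) ->
    (forall j, (j < n)%N -> i j <> i j.+1) ->
    psi (\big[@comp H H H/idfun]_(0 <= j < n.+1) a j) = 0.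

(* Mean 0, variance v > 0.  The law of a bounded self-adjoint X is compactly
   supported, hence is the measure with moments psi (X^m). *)
Definition semicircle_density (v x : R) : R :=
  Num.sqrt (4 * v - x ^+ 2) / (2 * pi * v).

Definition semicircular (X : H -> H) (v : R) :=
  forall m : nat, psi (iter m X) =
    (\int[@lebesgue_measure R]_(x in `[- (2 * Num.sqrt v), 2 * Num.sqrt v])
       (x ^+ m * semicircle_density v x))%:C.

Definition filtration (W : R -> H -> H) (t : R) : set (H -> H) :=
  generated_vna [set W tau | tau in `[0, t]].

Record free_brownian_motion (W : R -> H -> H) : Prop := {
  fbm_selfadjoint : forall t, 0 <= t -> selfadjoint_part F (W t);
  fbm_start : W 0 = 0;
  fbm_free : forall s t, 0 <= s -> s < t ->
    freely_independent (fun b : bool =>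
      if b then generated_vna [set W t - W s] else filtration W s);
  fbm_semicircular : forall s t, 0 <= s -> s < t ->
    semicircular (W t - W s) (t - s) }.

Section ThetaMethod.
Variables (W : R -> H -> H) (k : nat).
Variables (alpha : (H -> H) -> H -> H) (beta gamma : 'I_k -> (H -> H) -> H -> H).

Definition adapted_coefficient (f : (H -> H) -> H -> H) :=
  forall t, 0 <= t -> forall A, selfadjoint_part F A -> filtration W t A ->
    filtration W t (f A).

Definition noise (h : R) (U : nat -> H -> H) (n : nat) : H -> H :=
  \sum_(i < k) (beta i (U n) \o (W (n.+1%:R * h) - W (n%:R * h))
                             \o gamma i (U n)).

Record theta_solution (theta h : R) (U0 : H -> H) (U : nat -> H -> H) : Prop := {
  sol_selfadjoint : forall n, selfadjoint_part F (U n);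
  sol_adapted : forall n, filtration W (n%:R * h) (U n);
  sol_noise_selfadjoint : forall n, selfadjoint_part F (noise h U n);
  sol_start : U 0%N = U0;
  sol_step : forall n, U n.+1 =
    U n + ((1 - theta) * h)%:C *: alpha (U n)
        + (theta * h)%:C *: alpha (U n.+1) + noise h U n }.

End ThetaMethod.
End Trace.
End Operators.

(* Main.v *)
Require Import Defs.
From mathcomp Require Import all_boot all_order all_algebra.
From mathcomp Require Import complex.
From mathcomp Require Import all_classical all_reals all_analysis.
From mathcomp Require Import ring lra.
Import Order.TTheory GRing.Theory Num.Theory.
Import numFieldNormedType.Exports.

(** Write V_n = U_n - theta h alpha(U_n), the part of the scheme that is known
    explicitly, and N_n for the noise of step n.  The scheme reads
    V_{n+1} = U_n + (1 - theta) h alpha(U_n) + N_n.  The first two terms lie in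
    the algebra of the past, so by freeness and traciality they are orthogonal
    to N_n ([drift_noise_orthogonal]) and squaring gives
      |V_{n+1}|^2 = |V_n|^2 + 2 h psi(U_n alpha(U_n))
                    + (1 - 2 theta) h^2 |alpha(U_n)|^2 + |N_n|^2.

    The free analogue of the Ito isometry is the identity
    psi(D B D G) = psi(D^2) psi(B) psi(G) for a centred D free from B and G
    ([free_trace4]); with D = Delta W, whose second moment is h
    ([semicircle_variance]), it gives
    |beta Delta W gamma|^2 = h |beta|^2 |gamma|^2, whence
    |N_n|^2 <= k h sum_i |beta^i|^2 |gamma^i|^2 ([noise_norm2_le]).  This is the
    quantity that the dissipativity condition absorbs, and
      |V_{n+1}|^2 <= |V_n|^2 - h c |U_n|^2
    with c = 2 L - (1 - 2 theta) h K if theta < 1/2 and c = 2 L otherwise;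
    c > 0 in both cases.

    It remains to compare U_n with V_n.  Dissipativity makes
    psi(U alpha(U)) <= 0, so |U_n| <= |V_n|; linear growth gives
    |V_n|^2 <= M |U_n|^2 with M = 2 + 2 theta^2 h^2 K.  Thus |V_n|^2 is
    multiplied by at most 1 - h c / M <= exp(- h c / M) at each step, and the
    rate C = c / M works in both parts ([theta_exponential_decay]). *)

Set Implicit Arguments.
Unset Strict Implicit.
Unset Printing Implicit Defensive.

(** * Moments of the semicircle law *)

Lemma continuous_mul (R : realType) (f g : R -> R) :
  continuous f -> continuous g -> continuous (fun x => f x * g x).
Proof. by move=> cf cg x; apply: cvgM; [exact: cf|exact: cg]. Qed.

Section Semicircle.
Variables (R : realType) (v : R).
Hypothesis v_gt0 : 0 < v.

(** The substitution x = 2 sqrt v sin t turns the density into cos^2 t, up to a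
    constant, so that the moments only need a primitive P of a trigonometric
    polynomial; in the variable x itself the primitive of x^2 sqrt(4 v - x^2)
    involves arcsin, which is not differentiable at the ends of the support. *)
Lemma semicircle_moment_polar (m : nat) (P : R -> R) :
  (forall t : R, is_derive t 1 P
     ((2 * Num.sqrt v * sin t) ^+ m * ((2 * Num.sqrt v * cos t) ^+ 2
        / (2 * pi * v)))) ->
  \int[@lebesgue_measure R]_(x in `[- (2 * Num.sqrt v), 2 * Num.sqrt v])
      (x ^+ m * semicircle_density v x)
    = P (pi / 2) - P (- (pi / 2)).
Proof.
move=> dP.
set r := 2 * Num.sqrt v.
have r_gt0 : 0 < r by rewrite mulr_gt0 ?sqrtr_gt0.
have r2 : r ^+ 2 = 4 * v by rewrite exprMn sqr_sqrtr ?ltW//; ring.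
pose F t : R := r * sin t.
have dF (t : R) : is_derive t 1 F (r * cos t).
  exact: is_derive_eq.
have F'E : F^`()%classic = (fun t => r * cos t).
  by apply/funext => t; rewrite derive1E derive_val.
have cF : continuous F.
  by move=> t; apply/differentiable_continuous/derivable1_diffP.
have ccos : continuous (fun t : R => r * cos t).
  by apply: continuous_mul; [exact: cst_continuous|exact: continuous_cos].
have cF' : continuous F^`()%classic by rewrite F'E; exact: ccos.
pose G (x : R) := x ^+ m * semicircle_density v x.
have cS : continuous (fun x : R => Num.sqrt (4 * v - x ^+ 2)).
  move=> x; apply: (@continuous_comp _ _ _ (fun x : R => 4 * v - x ^+ 2)).
    by apply: continuousB; [exact: cst_continuous|exact: exprn_continuous].
  exact: sqrt_continuous.
have cG : continuous G.
  apply: continuous_mul; first exact: exprn_continuous.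
  by apply: continuous_mul cS _ => ?; exact: cst_continuous.
have cP : continuous P.
  by move=> t; apply/differentiable_continuous/derivable1_diffP.
have pi2 : - (pi / 2) < pi / 2 :> R by have := pi_gt0 R; lra.
have Fl : F (- (pi / 2)) = - r by rewrite /F sinN sin_pihalf mulrN1.
have Fr : F (pi / 2) = r by rewrite /F sin_pihalf mulr1.
rewrite /Rintegral -{1}Fl -{1}Fr.
rewrite (@integration_by_substitution_increasing _ F G); first last.
- exact: continuous_subspaceT.
- split; first by [].
  + by apply: cvg_at_right_filter; exact: cF.
  + by apply: cvg_at_left_filter; exact: cF.
- by apply/cvg_ex; eexists; apply: cvg_at_left_filter; exact: cF'.
- by apply/cvg_ex; eexists; apply: cvg_at_right_filter; exact: cF'.
- by move=> t _; exact: cF'.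
- by move=> x y xi yi xy; rewrite /F ltr_pM2l// ltr_sin.
- exact: ltW.
have -> : (\int[lebesgue_measure]_(x in `[(- (pi / 2))%R, (pi / 2)%R])
      (((G \o F) * F^`()%classic) x)%:E =
    \int[lebesgue_measure]_(t in `[(- (pi / 2))%R, (pi / 2)%R])
      ((r * sin t) ^+ m * ((r * cos t) ^+ 2 / (2 * pi * v)))%:E)%E.
  apply: eq_integral => t; rewrite inE/= in_itv/= => ti; congr EFin.
  rewrite !fctE F'E /G /F /semicircle_density.
  have cos0 : 0 <= cos t by apply: cos_ge0_pihalf.
  rewrite -r2 (_ : r ^+ 2 - _ = (r * cos t) ^+ 2); last first.
    by rewrite !exprMn sin2cos2; ring.
  rewrite sqrtr_sqr ger0_norm ?mulr_ge0 ?(ltW r_gt0)//; ring.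
rewrite (@continuous_FTC2 _ _ P)//.
- apply: continuous_subspaceT; apply: continuous_mul.
    move=> t; apply: (@continuous_comp _ _ _ F (fun x => x ^+ m)); first exact: cF.
    exact: exprn_continuous.
  apply: continuous_mul; last exact: cst_continuous.
  move=> t; apply: (@continuous_comp _ _ _ (fun t : R => r * cos t) (fun x => x ^+ 2)).
    exact: ccos.
  exact: exprn_continuous.
- split; first by [].
  + by apply: cvg_at_right_filter; exact: cP.
  + by apply: cvg_at_left_filter; exact: cP.
- by move=> t _; rewrite derive1E; have [_ ->] := dP t.
Qed.

Lemma semicircle_mean0 :
  \int[@lebesgue_measure R]_(x in `[- (2 * Num.sqrt v), 2 * Num.sqrt v])
      (x ^+ 1 * semicircle_density v x) = 0.
Proof.
have pi0 : pi != 0 :> R by rewrite gt_eqF ?pi_gt0.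
have v0 : v != 0 by rewrite gt_eqF.
pose P (t : R) : R :=
  - ((2 * Num.sqrt v) ^+ 3 / (3 * (2 * pi * v))) * cos t ^+ 3.
have dP (t : R) : is_derive t 1 P
    ((2 * Num.sqrt v * sin t) ^+ 1 * ((2 * Num.sqrt v * cos t) ^+ 2
        / (2 * pi * v))).
  apply: is_derive_eq; rewrite /GRing.scale/=.
  by move: (@pi R) pi0 => p p0; field; rewrite v0.
by rewrite (semicircle_moment_polar dP) /P cosN cos_pihalf expr0n mulr0 subrr.
Qed.

Lemma semicircle_variance :
  \int[@lebesgue_measure R]_(x in `[- (2 * Num.sqrt v), 2 * Num.sqrt v])
      (x ^+ 2 * semicircle_density v x) = v.
Proof.
have pi0 : pi != 0 :> R by rewrite gt_eqF ?pi_gt0.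
have v0 : v != 0 by rewrite gt_eqF.
have r4 : (2 * Num.sqrt v) ^+ 4 = 16 * v ^+ 2.
  by rewrite exprMn [Num.sqrt v ^+ 4](exprM _ 2 2) sqr_sqrtr ?ltW//; ring.
pose c := (2 * Num.sqrt v) ^+ 4 / (8 * (2 * pi * v)).
pose P (t : R) : R := c * (t - sin t * cos t * (cos t ^+ 2 - sin t ^+ 2)).
have dP (t : R) : is_derive t 1 P
    ((2 * Num.sqrt v * sin t) ^+ 2 * ((2 * Num.sqrt v * cos t) ^+ 2
        / (2 * pi * v))).
  apply: is_derive_eq; rewrite /GRing.scale/=.
  (* cos^2 + sin^2 = 1 makes the derivative homogeneous of degree four. *)
  transitivity (c * (8 * sin t ^+ 2 * cos t ^+ 2)).
    rewrite [X in c * (X - _)](_ : 1 = (cos t ^+ 2 + sin t ^+ 2) ^+ 2); last first.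
      by rewrite cos2Dsin2 expr1n.
    ring.
  by rewrite /c; move: (@pi R) pi0 => p p0; field; rewrite v0.
rewrite (semicircle_moment_polar dP) /P cosN cos_pihalf /c r4.
by move: (@pi R) pi0 => p p0; field; rewrite v0.
Qed.

End Semicircle.

(** * Algebras of operators *)

Lemma ReD (R : realType) (z w : R[i]) : complex.Re (z + w) = complex.Re z + complex.Re w.
Proof. by case: z w => [? ?] [? ?]. Qed.

Lemma ReZ (R : realType) (c : R) (z : R[i]) : complex.Re (c%:C * z) = c * complex.Re z.
Proof. by case: z => x y; rewrite /= mul0r subr0. Qed.

Section Operators.
Context {R : realType} {H : completeNormedModType R[i]}.
Variable dot : {dot H for (@Num.conj R[i])}.
Hypothesis Hdot : hilbert_inner_product dot.
Implicit Types (A B C X : H -> H) (S F : set (H -> H)).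

Lemma is_adjoint_uniq A B C : is_adjoint dot A B -> is_adjoint dot A C -> B = C.
Proof.
move=> AB AC; apply/funext => y; apply/eqP; rewrite -subr_eq0 -normr_eq0.
by rewrite -sqrf_eq0 Hdot linearBr/= -AB -AC subrr.
Qed.

Lemma starE A B : is_adjoint dot A B -> star dot A = B.
Proof.
move=> AB; apply: (@is_adjoint_uniq A) => //.
exact: (@xgetI _ _ [set B | is_adjoint dot A B] _ AB).
Qed.

Lemma is_adjointD A A' B B' : is_adjoint dot A A' -> is_adjoint dot B B' ->
  is_adjoint dot (A + B) (A' + B').
Proof.
by move=> hA hB x y; rewrite fctE linearDl/= hA hB -linearDr.
Qed.

Lemma is_adjointN A A' : is_adjoint dot A A' -> is_adjoint dot (- A) (- A').
Proof. by move=> hA x y; rewrite fctE linearNl/= hA -linearNr. Qed.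

Lemma is_adjoint_sum (I : Type) (r : seq I) (X Y : I -> H -> H) :
  (forall i, is_adjoint dot (X i) (Y i)) ->
  is_adjoint dot (\sum_(i <- r) X i) (\sum_(i <- r) Y i).
Proof.
move=> XY; elim/big_ind2: _ => [x y|A A' B B'|//].
  by rewrite linear0l linear0r.
exact: is_adjointD.
Qed.

Lemma is_adjoint_comp A A' B B' : is_adjoint dot A A' -> is_adjoint dot B B' ->
  is_adjoint dot (A \o B) (B' \o A').
Proof. by move=> hA hB x y; rewrite /= hA hB. Qed.

Lemma is_adjointZ (c : R) A A' : is_adjoint dot A A' ->
  is_adjoint dot (c%:C *: A) (c%:C *: A').
Proof.
move=> hA x y; rewrite !fctE linearZl_LR/= linearZr_LR/= hA.
by have -> : Num.conj c%:C = c%:C by exact: conjc_real.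
Qed.

(** The bound in the definition may have any sign when H is zero; a
    nonnegative one is needed to bound products. *)
Lemma bounded_operatorP A : bounded_operator A ->
  linear A /\ exists2 M : R[i], 0 <= M & forall x, `|A x| <= M * `|x|.
Proof.
move=> [linA [M hM]]; split => //; exists `|M| => // x.
rewrite (le_trans (hM x))//.
by rewrite -[leLHS]ger0_norm ?normrM ?normr_id// (le_trans _ (hM x)).
Qed.

(** Unlike the bicommutant property, these closure properties pass at once to
    an intersection, which is what a generated von Neumann algebra, hence the
    filtration, is. *)
Record operator_algebra S : Prop := {
  alg_linear : forall A, S A -> linear A;
  alg_id : S idfun;
  alg_lincomb : forall c A B, S A -> S B -> S (c *: A + B);
  alg_comp : forall A B, S A -> S B -> S (A \o B) }.

Lemma commutant_algebra S :
  (forall B, S B -> linear B) -> operator_algebra (commutant S).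
Proof.
move=> linS; split.
- by move=> A [[]].
- split=> //; split=> //; exists 1 => x; by rewrite mul1r.
- move=> c A B [/bounded_operatorP[linA [M M0 hM]] cA].
  move=> [/bounded_operatorP[linB [N N0 hN]] cB]; split.
    split.
      move=> a x y; rewrite !fctE linA linB !scalerDr !scalerA.
      by rewrite [c * a]mulrC !addrA; congr (_ + _); rewrite addrAC.
    exists (`|c| * M + N) => x; rewrite !fctE mulrDl.
    rewrite (le_trans (ler_normD _ _))// lerD// normrZ -mulrA.
    by rewrite ler_wpM2l.
  move=> E SE; apply/funext => x; rewrite /= !fctE linS//.
  by congr (_ *: _ + _); [have /(congr1 (@^~ x)) := cA _ SE|
     have /(congr1 (@^~ x)) := cB _ SE].
- move=> A B [/bounded_operatorP[linA [M M0 hM]] cA].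
  move=> [/bounded_operatorP[linB [N N0 hN]] cB]; split.
    split; first by move=> a x y; rewrite /= linB linA.
    exists (M * N) => x /=; rewrite (le_trans (hM _))// -mulrA.
    by rewrite ler_wpM2l.
  by move=> E SE; rewrite -compA cB// compA cA.
Qed.

Lemma vna_algebra S : von_neumann_algebra dot S -> operator_algebra S.
Proof.
by move=> [_ <-]; apply: commutant_algebra => B [[]].
Qed.

Section Algebra.
Variables (S : set (H -> H)) (S_alg : operator_algebra S).

Lemma alg0 : S 0.
Proof.
by have := alg_lincomb S_alg (-1) (alg_id S_alg) (alg_id S_alg); rewrite scaleN1r addNr.
Qed.

Lemma algZ c A : S A -> S (c *: A).
Proof. by move=> SA; rewrite -[_ *: _]addr0; apply: alg_lincomb alg0. Qed.

Lemma algD A B : S A -> S B -> S (A + B).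
Proof. by move=> SA SB; rewrite -[A]scale1r; apply: alg_lincomb. Qed.

Lemma algB A B : S A -> S B -> S (A - B).
Proof. by move=> SA SB; rewrite addrC -scaleN1r; apply: alg_lincomb. Qed.

Lemma alg_sum (I : Type) (r : seq I) (X : I -> H -> H) :
  (forall i, S (X i)) -> S (\sum_(i <- r) X i).
Proof. by move=> SX; elim/big_ind: _ => //; [exact: alg0|exact: algD]. Qed.

Lemma compDl A B C : (A + B) \o C = (A \o C) + (B \o C).
Proof. by []. Qed.

Lemma compBl A B C : (A - B) \o C = (A \o C) - (B \o C).
Proof. by []. Qed.

Lemma compZl c A B : (c *: A) \o B = c *: (A \o B).
Proof. by []. Qed.

Lemma compDr A B C : S A -> A \o (B + C) = (A \o B) + (A \o C).
Proof.
move=> /(alg_linear S_alg) linA; apply/funext => x.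
by have := linA 1 (B x) (C x); rewrite !scale1r.
Qed.

Lemma compZr c A B : S A -> A \o (c *: B) = c *: (A \o B).
Proof.
move=> /(alg_linear S_alg) linA; apply/funext => x.
have A0 : A 0 = 0.
  by have := linA (-1) 0 0; rewrite scaler0 addr0 scaleN1r addNr.
by have := linA c (B x) 0; rewrite addr0 A0 addr0.
Qed.

Lemma compBr A B C : S A -> A \o (B - C) = (A \o B) - (A \o C).
Proof. by move=> SA; rewrite -scaleN1r compDr// compZr// scaleN1r. Qed.

Lemma comp_suml (I : Type) (r : seq I) (X : I -> H -> H) B :
  (\sum_(i <- r) X i) \o B = \sum_(i <- r) (X i \o B).
Proof. by elim/big_ind2: _ => // A A' C C' <- <-. Qed.

Lemma comp_sumr (I : Type) (r : seq I) (X : I -> H -> H) A : S A ->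
  A \o (\sum_(i <- r) X i) = \sum_(i <- r) (A \o X i).
Proof.
move=> SA; elim/big_ind2: _ => // [|B B' C C' <- <-].
  by have := compZr 0 0 SA; rewrite !scale0r.
exact: compDr.
Qed.

End Algebra.

(** The hypothesis provides a member of the intersection, without which its
    elements would not have to be linear. *)
Lemma generated_vna_algebra S :
  (exists2 F, von_neumann_algebra dot F & S `<=` F) ->
  operator_algebra (generated_vna dot S).
Proof.
move=> [F F_vna SF]; split.
- by move=> A /(_ F (conj F_vna SF)) /(alg_linear (vna_algebra F_vna)).
- by move=> E [/vna_algebra/alg_id].
- move=> c A B hA hB E [vE SE].
  by apply: (alg_lincomb (vna_algebra vE)); [exact: hA|exact: hB].
- move=> A B hA hB E [vE SE].
  by apply: (alg_comp (vna_algebra vE)); [exact: hA|exact: hB].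
Qed.

(** * The trace and freeness *)

Section Trace.
Variables (F : set (H -> H)) (psi : (H -> H) -> R[i]).
Hypotheses (F_vna : von_neumann_algebra dot F)
  (psi_trace : faithful_unital_normal_trace dot F psi).
Let F_alg := vna_algebra F_vna.

Lemma trace0 : psi 0 = 0.
Proof.
have := trace_linear psi_trace (-1) (alg_id F_alg) (alg_id F_alg).
by rewrite scaleN1r addNr (trace_unital psi_trace) mulr1 addNr.
Qed.

Lemma traceD A B : F A -> F B -> psi (A + B) = psi A + psi B.
Proof.
by move=> FA FB; have := trace_linear psi_trace 1 FA FB; rewrite scale1r mul1r.
Qed.

Lemma traceZ c A : F A -> psi (c *: A) = c * psi A.
Proof.
move=> FA; have := trace_linear psi_trace c FA (alg0 F_alg).
by rewrite !addr0 trace0 addr0.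
Qed.

Lemma traceB A B : F A -> F B -> psi (A - B) = psi A - psi B.
Proof.
move=> FA FB; have := trace_linear psi_trace (-1) FB FA.
by rewrite scaleN1r mulN1r addrC [RHS]addrC.
Qed.

Lemma trace_sum (I : Type) (r : seq I) (X : I -> H -> H) :
  (forall i, F (X i)) -> psi (\sum_(i <- r) X i) = \sum_(i <- r) psi (X i).
Proof.
move=> FX; elim: r => [|i r IH]; first by rewrite !big_nil trace0.
by rewrite !big_cons traceD// ?IH//; apply: alg_sum.
Qed.

Definition centered A : H -> H := A - psi A *: idfun.

Lemma trace_centered A : F A -> psi (centered A) = 0.
Proof.
move=> FA; have FI := alg_id F_alg.
by rewrite traceB// ?traceZ// ?(trace_unital psi_trace) ?mulr1 ?subrr//; apply: algZ.
Qed.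

Lemma centeredK A : centered A + psi A *: idfun = A.
Proof. by rewrite subrK. Qed.

Lemma comp_centered A B : F A ->
  A \o B = (A \o centered B) + psi B *: A.
Proof.
by move=> FA; rewrite -{1}[B]centeredK (compDr F_alg)// (compZr F_alg).
Qed.

Section Freeness.
Variables D E : set (H -> H).
Hypotheses (D_alg : operator_algebra D) (E_alg : operator_algebra E).
Hypotheses (DF : D `<=` F) (EF : E `<=` F).
Hypothesis free : freely_independent psi (fun b : bool => if b then D else E).

Let big_comp_recl n (a : nat -> H -> H) :
  \big[@comp H H H/idfun]_(0 <= j < n.+1) a j
  = a 0%N \o \big[@comp H H H/idfun]_(0 <= j < n) a j.+1.
Proof.
by rewrite big_ltn// big_add1.
Qed.

(* The pattern is E D, so the letters of odd rank come from D. *)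
Let trace_centered_comp A B : E A -> psi A = 0 -> D B -> psi B = 0 ->
  psi (A \o B) = 0.
Proof.
move=> EA A0 DB B0.
have := @free 1 (fun j => odd j) (fun j => if odd j then B else A).
rewrite !big_comp_recl big_geq//=; apply=> j; first by case: odd.
by rewrite /=; case: odd.
Qed.

(** Centring both letters leaves a single alternating word, which has trace
    zero by freeness. *)
Lemma free_trace2 A B : E A -> D B -> psi (A \o B) = psi A * psi B.
Proof.
move=> EA DB; have FI := alg_id F_alg.
have [FA FB] := (EF EA, DF DB).
have EA' : E (centered A) by apply: algB => //; apply: algZ => //; exact: alg_id.
have DB' : D (centered B) by apply: algB => //; apply: algZ => //; exact: alg_id.
have [FA' FB'] := (EF EA', DF DB').
have split_A : A \o B = (centered A \o B) + psi A *: B.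
  by rewrite -{1}[A]centeredK.
have FM X Y : F X -> F Y -> F (X \o Y) by exact: (alg_comp F_alg).
have FZ c X : F X -> F (c *: X) by exact: algZ.
rewrite split_A traceD ?traceZ//; [|exact: FM|exact: FZ].
rewrite (comp_centered B FA') traceD ?traceZ//; [|exact: FM|exact: FZ].
by rewrite trace_centered_comp ?trace_centered// mulr0 !add0r.
Qed.

(** The free counterpart of the Ito isometry.  Centring B and C produces the
    alternating word A B' A C', of trace zero, and words in which cyclicity
    brings the two letters A together, so that [free_trace2] applies. *)
Lemma free_trace4 A B C : D A -> psi A = 0 -> E B -> E C ->
  psi (A \o B \o A \o C) = psi (A \o A) * (psi B * psi C).
Proof.
move=> DA A0 EB EC; have FI := alg_id F_alg.
have [FA [FB FC]] := (DF DA, (EF EB, EF EC)).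
have EB' : E (centered B) by apply: algB => //; apply: algZ => //; exact: alg_id.
have EC' : E (centered C) by apply: algB => //; apply: algZ => //; exact: alg_id.
have [FB' FC'] := (EF EB', EF EC').
have FM X Y : F X -> F Y -> F (X \o Y) by exact: (alg_comp F_alg).
have FZ c X : F X -> F (c *: X) by exact: algZ.
have word0 : psi (A \o centered B \o A \o centered C) = 0.
  have := @free 3 (fun j => ~~ odd j)
    (fun j => if j == 1%N then centered B else if j == 3 then centered C else A).
  rewrite !big_comp_recl big_geq//=; apply=> j; last by rewrite /=; case: odd.
  by case: j => [|[|[|[|//]]]] _ /=; rewrite ?trace_centered.
(* By cyclicity the two letters A merge into A^2. *)
have word3 : psi (A \o centered B \o A) = 0.
  rewrite (trace_tracial psi_trace)//; last exact: FM.
  rewrite compA (trace_tracial psi_trace)//; last exact: FM.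
  rewrite free_trace2//; last exact: (alg_comp D_alg).
  by rewrite trace_centered// mul0r.
have wordAAC : psi (A \o A \o C) = psi C * psi (A \o A).
  rewrite (trace_tracial psi_trace)//; last exact: FM.
  by rewrite free_trace2//; exact: (alg_comp D_alg).
have split_B : A \o B \o A \o C
    = (A \o centered B \o A \o C) + psi B *: (A \o A \o C).
  by rewrite (comp_centered B FA).
have FABA : F (A \o centered B \o A) by apply/FM => //; exact: FM.
rewrite split_B (comp_centered C FABA) traceD ?traceZ// ?traceD ?traceZ//.
- by rewrite word0 word3 wordAAC mulr0 !add0r; ring.
- by apply/FM => //; exact: EF.
- exact: FZ.
- by apply/FM => //; exact: FM.
- apply: (algD F_alg); last exact: FZ.
  by apply/FM => //; exact: EF.
- by apply: FZ; apply/FM => //; exact: FM.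
Qed.

End Freeness.

(** * The L2 norm *)

Notation ip A B := (complex.Re (psi (A \o B))).

(** The norm is the square root of a real part only; positivity of the trace
    rules out an imaginary part. *)
Lemma trace_real A B : F A -> is_adjoint dot A B ->
  psi (B \o A) = (norm2 dot psi A ^+ 2)%:C.
Proof.
move=> FA AB; have := trace_positive psi_trace FA.
rewrite /norm2 (starE AB) lecE => /andP[/eqP/= im0 re0].
by rewrite sqr_sqrtr//; case: (psi _) im0 re0 => x y /= -> _.
Qed.

Lemma norm2_ip A B : F A -> is_adjoint dot A B -> norm2 dot psi A ^+ 2 = ip B A.
Proof. by move=> FA AB; rewrite (trace_real FA AB). Qed.

Lemma ip_ge0 A B : F A -> is_adjoint dot A B -> 0 <= ip B A.
Proof. by move=> FA AB; rewrite -(norm2_ip FA AB) sqr_ge0. Qed.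

Lemma ipC A B : F A -> F B -> ip A B = ip B A.
Proof. by move=> FA FB; rewrite (trace_tracial psi_trace). Qed.

(** The Cauchy-Schwarz bound |sum_i X_i|^2 <= k sum_i |X_i|^2, where Y_i is the
    adjoint of X_i.  It follows from |X_i - X_j|^2 >= 0 summed over all pairs
    (i, j), without any square root. *)
Lemma ip_sum_le (k : nat) (X Y : 'I_k -> H -> H) :
  (forall i, F (X i)) -> (forall i, F (Y i)) ->
  (forall i, is_adjoint dot (X i) (Y i)) ->
  ip (\sum_i Y i) (\sum_i X i) <= k%:R * \sum_i ip (Y i) (X i).
Proof.
move=> FX FY XY.
have FM A B : F A -> F B -> F (A \o B) by exact: (alg_comp F_alg).
have ij i j : ip (Y i) (X j) + ip (Y j) (X i) <= ip (Y i) (X i) + ip (Y j) (X j).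
  have FXB : F (X i - X j) by exact: (algB F_alg).
  have := ip_ge0 FXB (is_adjointD (XY i) (is_adjointN (XY j))).
  rewrite compBl !(compBr F_alg)// !traceB//; try exact: FM;
    try by apply: (algB F_alg); exact: FM.
  move: (psi _) (psi _) (psi _) (psi _) => [? ?] [? ?] [? ?] [? ?] /=.
  by lra.
have sumE : ip (\sum_i Y i) (\sum_i X i) = \sum_i \sum_j ip (Y i) (X j).
  rewrite comp_suml trace_sum; last first.
    by move=> i; apply: FM => //; exact: (alg_sum F_alg).
  rewrite (big_morph _ (@ReD R) (erefl : complex.Re 0 = 0)).
  apply: eq_bigr => i _; rewrite (comp_sumr F_alg)// trace_sum//.
    by rewrite (big_morph _ (@ReD R) (erefl : complex.Re 0 = 0)).
  by move=> j; exact: FM.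
set T := \sum_i ip (Y i) (X i).
have : \sum_i \sum_j (ip (Y i) (X j) + ip (Y j) (X i))
    <= \sum_(i < k) \sum_(j < k) (ip (Y i) (X i) + ip (Y j) (X j)).
  by apply: ler_sum => i _; apply: ler_sum => j _; exact: ij.
under eq_bigr do rewrite big_split/=.
rewrite big_split/= [X in _ + X]exchange_big/= -sumE.
under [leRHS]eq_bigr do rewrite big_split/= sumr_const card_ord.
rewrite big_split/= sumr_const card_ord sumrMnl -/T.
by rewrite -[T *+ k]mulr_natl; lra.
Qed.

(** * Brownian increments and the noise *)

Section BrownianIncrement.
Variables (W : R -> H -> H) (W_fbm : free_brownian_motion dot F psi W).

Let filtration_vna (t : R) :
  exists2 G, von_neumann_algebra dot G & [set W tau | tau in `[0, t]] `<=` G.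
Proof.
exists F => // A [tau /=]; rewrite in_itv/= => /andP[tau0 _] <-.
by have [] := fbm_selfadjoint W_fbm tau0.
Qed.

Lemma filtration_algebra (t : R) : operator_algebra (filtration dot W t).
Proof. exact: generated_vna_algebra. Qed.

Lemma filtration_sub (t : R) : filtration dot W t `<=` F.
Proof.
move=> A; apply; split => // B [tau /=]; rewrite in_itv/= => /andP[tau0 _] <-.
by have [] := fbm_selfadjoint W_fbm tau0.
Qed.

Variables s t : R.
Hypotheses (s_ge0 : 0 <= s) (lt_st : s < t).
Let dW := W t - W s.

Lemma increment_sa : selfadjoint_part dot F dW.
Proof.
have [Fs As] := fbm_selfadjoint W_fbm s_ge0.
have [Ft At] := fbm_selfadjoint W_fbm (le_trans s_ge0 (ltW lt_st)).
by split; [exact: (algB F_alg)|exact: is_adjointD At (is_adjointN As)].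
Qed.

Let D := generated_vna dot [set dW].

Let D_vna : exists2 G, von_neumann_algebra dot G & [set dW] `<=` G.
Proof. by exists F => // B ->; have [] := increment_sa. Qed.

Let D_alg : operator_algebra D. Proof. exact: generated_vna_algebra. Qed.

Let DF : D `<=` F.
Proof. by move=> A; apply; split => // B ->; have [] := increment_sa. Qed.

Let D_dW : D dW. Proof. by move=> G [_]; apply. Qed.

Lemma increment_mean0 : psi dW = 0.
Proof.
have := fbm_semicircular W_fbm s_ge0 lt_st 1.
by rewrite /= semicircle_mean0 ?subr_gt0.
Qed.

Lemma increment_variance : psi (dW \o dW) = (t - s)%:C.
Proof.
have := fbm_semicircular W_fbm s_ge0 lt_st 2.
by rewrite /= semicircle_variance ?subr_gt0.
Qed.

Lemma trace_comp_increment A : filtration dot W s A -> psi (A \o dW) = 0.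
Proof.
move=> EA.
rewrite (free_trace2 D_alg (filtration_algebra s) DF (@filtration_sub s)
  (fbm_free W_fbm s_ge0 lt_st))//.
by rewrite increment_mean0 mulr0.
Qed.

Lemma trace_comp_increment2 B C :
  filtration dot W s B -> filtration dot W s C ->
  psi (dW \o B \o dW \o C) = (t - s)%:C * (psi B * psi C).
Proof.
move=> EB EC.
rewrite (free_trace4 D_alg (filtration_algebra s) DF (@filtration_sub s)
  (fbm_free W_fbm s_ge0 lt_st))//.
  by rewrite increment_variance.
exact: increment_mean0.
Qed.

Section Noise.
Variables (k : nat) (B C : 'I_k -> H -> H).
Hypotheses (B_sa : forall i, selfadjoint_part dot F (B i))
  (C_sa : forall i, selfadjoint_part dot F (C i)).
Hypotheses (EB : forall i, filtration dot W s (B i))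
  (EC : forall i, filtration dot W s (C i)).
Let N := \sum_(i < k) (B i \o dW \o C i).

Let F_noise_term i : F (B i \o dW \o C i).
Proof.
have FM X Y : F X -> F Y -> F (X \o Y) by exact: (alg_comp F_alg).
have [[[FB _] [FC _]] [FdW _]] := (B_sa i, C_sa i, increment_sa).
by apply/FM => //; exact: FM.
Qed.

(** By cyclicity psi(A B_i dW C_i) = psi((C_i A B_i) dW): the past on the left,
    a centred increment on the right. *)
Lemma drift_noise_orthogonal A : filtration dot W s A -> psi (A \o N) = 0.
Proof.
move=> EA; have E_alg := filtration_algebra s.
have [FdW _] := increment_sa.
have FE X : filtration dot W s X -> F X := @filtration_sub s X.
have FM X Y : F X -> F Y -> F (X \o Y) by exact: (alg_comp F_alg).
rewrite (comp_sumr F_alg) ?trace_sum; last exact: FE.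
  rewrite big1// => i _; rewrite 2!compA (trace_tracial psi_trace).
  - rewrite [X in psi X](_ : _ = (C i \o (A \o B i)) \o dW)//.
    exact: (trace_comp_increment (alg_comp E_alg (EC i) (alg_comp E_alg EA (EB i)))).
  - exact: FM (FE _ (alg_comp E_alg EA (EB i))) FdW.
  - exact: FE.
by move=> i; apply: FM; [exact: FE|exact: F_noise_term].
Qed.

(** The single terms B_i dW C_i need not be self-adjoint even though N is; their
    adjoints C_i dW B_i have the same sum as they do, since N is its own
    adjoint.  This is where self-adjointness of the noise is used. *)
Lemma noise_norm2_le : selfadjoint_part dot F N ->
  norm2 dot psi N ^+ 2 <= k%:R * ((t - s) *
    \sum_(i < k) norm2 dot psi (B i) ^+ 2 * norm2 dot psi (C i) ^+ 2).
Proof.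
move=> [FN NN]; have [FdW AdW] := increment_sa.
have E_alg := filtration_algebra s.
have FM X Y : F X -> F Y -> F (X \o Y) by exact: (alg_comp F_alg).
pose X i := B i \o dW \o C i; pose Y i := C i \o (dW \o B i).
have FY i : F (Y i).
  have [FB _] := B_sa i; have [FC _] := C_sa i.
  by apply/FM => //; exact: FM.
have XY i : is_adjoint dot (X i) (Y i).
  have [_ AB] := B_sa i; have [_ AC] := C_sa i.
  by apply: is_adjoint_comp AC; exact: is_adjoint_comp AB AdW.
have NE : \sum_i Y i = N.
  by apply: is_adjoint_uniq NN; exact: is_adjoint_sum XY.
rewrite (norm2_ip FN NN) -{1}NE; apply: le_trans (ip_sum_le F_noise_term FY XY) _.
rewrite ler_wpM2l// mulr_sumr; apply: ler_sum => i _.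
have [FB AB] := B_sa i; have [FC AC] := C_sa i.
(* psi(C dW B B dW C) = psi(dW B^2 dW C^2) by cyclicity. *)
rewrite [X in psi X](_ : _ = C i \o (dW \o (B i \o B i) \o dW \o C i))//.
rewrite (trace_tracial psi_trace)//; last by do 3?apply/FM => //; exact: FM.
rewrite [X in psi X](_ : _ = dW \o (B i \o B i) \o dW \o (C i \o C i))//.
rewrite trace_comp_increment2//; try exact: (alg_comp E_alg).
by rewrite !trace_real// ReZ ReZ.
Qed.

End Noise.
End BrownianIncrement.

(** * The theta method *)

Section ThetaMethod.
Variables (W : R -> H -> H) (W_fbm : free_brownian_motion dot F psi W).
Variables (k : nat) (alpha : (H -> H) -> H -> H)
  (beta gamma : 'I_k -> (H -> H) -> H -> H).
Hypotheses
  (alpha_sa : forall U, selfadjoint_part dot F U ->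
     selfadjoint_part dot F (alpha U))
  (beta_sa : forall i U, selfadjoint_part dot F U ->
     selfadjoint_part dot F (beta i U))
  (gamma_sa : forall i U, selfadjoint_part dot F U ->
     selfadjoint_part dot F (gamma i U))
  (alpha_adapted : adapted_coefficient dot F W alpha)
  (beta_adapted : forall i, adapted_coefficient dot F W (beta i))
  (gamma_adapted : forall i, adapted_coefficient dot F W (gamma i)).

Notation sq A := (norm2 dot psi A ^+ 2).

Lemma norm2_lincomb A B (c : R) :
  selfadjoint_part dot F A -> selfadjoint_part dot F B ->
  sq (A + c%:C *: B) = sq A + 2 * c * ip A B + c ^+ 2 * sq B.
Proof.
move=> [FA AA] [FB BB].
have FM X Y : F X -> F Y -> F (X \o Y) by exact: (alg_comp F_alg).
have FcB : F (c%:C *: B) by exact: algZ.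
have FS : F (A + c%:C *: B) by exact: (algD F_alg).
rewrite (norm2_ip FS (is_adjointD AA (is_adjointZ c BB))).
rewrite (norm2_ip FA AA) (norm2_ip FB BB).
rewrite compDl !(compDr F_alg)// !traceD//; try exact: FM;
  try by apply: (algD F_alg); exact: FM.
rewrite !compZl !(compZr F_alg)// !traceZ//; try exact: FM;
  try by apply: algZ => //; exact: FM.
rewrite !ReD !ReZ (ipC FB FA); ring.
Qed.

Variables (L K theta h : R).
Hypotheses (L_gt0 : 0 < L) (K_gt0 : 0 < K) (theta_ge0 : 0 <= theta)
  (h_gt0 : 0 < h).
Hypothesis dissipative : forall U, selfadjoint_part dot F U ->
  psi (U \o alpha U)
    + (k%:R / 2 * \sum_(i < k) norm2 dot psi (beta i U) ^+ 2
                              * norm2 dot psi (gamma i U) ^+ 2)%:C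
  <= (- L * norm2 dot psi U ^+ 2)%:C.
Hypothesis growth : forall U, selfadjoint_part dot F U ->
  norm2 dot psi (alpha U) ^+ 2 <= K * norm2 dot psi U ^+ 2.

Let dissipative_Re U : selfadjoint_part dot F U ->
  ip U (alpha U) + k%:R / 2 * \sum_(i < k) sq (beta i U) * sq (gamma i U)
    <= - L * sq U.
Proof.
by move=> /dissipative; rewrite lecE => /andP[_]; rewrite ReD.
Qed.

Definition implicit_part U : H -> H := U - (theta * h)%:C *: alpha U.

Lemma implicit_partE U :
  implicit_part U = U + (- (theta * h))%:C *: alpha U.
Proof. by rewrite /implicit_part rmorphN scaleNr. Qed.

(** The cross term of |U - theta h alpha(U)|^2 is - 2 theta h psi(U alpha(U)),
    which dissipativity makes nonnegative. *)
Lemma norm2_le_implicit_part U : selfadjoint_part dot F U ->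
  sq U <= sq (implicit_part U).
Proof.
move=> saU; rewrite implicit_partE norm2_lincomb//; last exact: alpha_sa.
have := dissipative_Re saU.
set S := \sum_(i < k) _; set b := ip _ _; set a := sq (alpha U) => hb.
have S0 : 0 <= k%:R / 2 * S.
  by rewrite mulr_ge0 ?divr_ge0// sumr_ge0// => i _; rewrite mulr_ge0 ?sqr_ge0.
have b0 : b <= 0.
  have : 0 <= L * sq U by rewrite mulr_ge0 ?sqr_ge0 ?ltW.
  by lra.
have th0 : 0 <= theta * h by rewrite mulr_ge0// ltW.
have : 0 <= (theta * h) ^+ 2 * a by rewrite mulr_ge0 ?sqr_ge0.
have : 0 <= theta * h * - b by rewrite mulr_ge0// oppr_ge0.
by lra.
Qed.

Lemma implicit_part_norm2_le U : selfadjoint_part dot F U ->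
  sq (implicit_part U) <= (2 + 2 * (theta * h) ^+ 2 * K) * sq U.
Proof.
move=> saU; have saA := alpha_sa saU.
(* parallelogram law: |U - cA|^2 = 2 |U|^2 + 2 c^2 |A|^2 - |U + cA|^2 *)
have := sqr_ge0 (norm2 dot psi (U + (theta * h)%:C *: alpha U)).
rewrite implicit_partE !norm2_lincomb//.
have := ler_wpM2l (sqr_ge0 (theta * h)) (growth saU).
by nra.
Qed.

(** Dissipativity at weight 2 h absorbs exactly the noise, because its factor
    k / 2 becomes the factor k h of [noise_norm2_le]. *)
Lemma theta_step_norm2 U0 U n : theta_solution dot F W alpha beta gamma theta h U0 U ->
  sq (implicit_part (U n.+1)) <=
    sq (implicit_part (U n)) + h * ((1 - 2 * theta) * h * sq (alpha (U n))
      - 2 * L * sq (U n)).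
Proof.
move=> sol; have saU := sol_selfadjoint sol n; have saA := alpha_sa saU.
set N := noise W beta gamma h U n.
have saN : selfadjoint_part dot F N := sol_noise_selfadjoint sol n.
have nh_ge0 : 0 <= n%:R * h by apply: mulr_ge0 => //; exact: ltW.
have lt_nh : n%:R * h < n.+1%:R * h by rewrite ltr_pM2r// ltr_nat.
have EU : filtration dot W (n%:R * h) (U n) by exact: (sol_adapted sol).
have EA : filtration dot W (n%:R * h) (alpha (U n)).
  exact: (alpha_adapted nh_ge0 saU EU).
pose X := U n + ((1 - theta) * h)%:C *: alpha (U n).
have saX : selfadjoint_part dot F X.
  case: saU saA => [FU AU] [FA AA]; split.
    by apply: (algD F_alg) => //; exact: algZ.
  exact: is_adjointD AU (is_adjointZ _ AA).
have EX : filtration dot W (n%:R * h) X.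
  have E_alg := filtration_algebra W_fbm (n%:R * h).
  exact: (algD E_alg EU (algZ E_alg _ EA)).
(* The factor 1 lets [norm2_lincomb] expand the square. *)
have step : implicit_part (U n.+1) = X + 1%:C *: N.
  by rewrite /implicit_part {1}(sol_step sol) scale1r addrAC addrK.
rewrite step norm2_lincomb//.
have EB i : filtration dot W (n%:R * h) (beta i (U n)).
  exact: (beta_adapted i nh_ge0 saU EU).
have EG i : filtration dot W (n%:R * h) (gamma i (U n)).
  exact: (gamma_adapted i nh_ge0 saU EU).
have saB i := beta_sa i saU; have saG i := gamma_sa i saU.
have XN : psi (X \o N) = 0.
  exact: (drift_noise_orthogonal W_fbm nh_ge0 lt_nh saB saG EB EG EX).
have hN : sq N <= k%:R * ((n.+1%:R * h - n%:R * h) *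
    \sum_(i < k) sq (beta i (U n)) * sq (gamma i (U n))).
  exact: (noise_norm2_le W_fbm nh_ge0 lt_nh saB saG EB EG saN).
move: hN; rewrite XN -mulrBl -natrB// subSnn mul1r => hN.
have hS := dissipative_Re saU.
rewrite /X implicit_partE !norm2_lincomb//.
set S := \sum_(i < k) _ in hN hS.
have : h * (ip (U n) (alpha (U n)) + k%:R / 2 * S) <= h * (- L * sq (U n)).
  by rewrite ler_wpM2l// ltW.
move: hN; rewrite /= => hN hb; clear hS.
move: S (ip _ _) (sq _) (sq _) (sq _) hN hb => S b a u N2 hN hb.
lra.
Qed.

(** Both regimes of theta at once: c is the part of the dissipation 2 L that
    the quadratic drift term leaves. *)
Lemma theta_exponential_decay (c : R) : 0 < c ->
  (forall U, selfadjoint_part dot F U ->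
     (1 - 2 * theta) * h * sq (alpha U) <= (2 * L - c) * sq U) ->
  exists C : R, 0 < C /\ forall U0 U,
    theta_solution dot F W alpha beta gamma theta h U0 U ->
    forall n, sq (U n) <= expR (- (C * n%:R * h)) * sq (implicit_part U0).
Proof.
move=> c_gt0 hc; pose M := 2 + 2 * (theta * h) ^+ 2 * K.
have M_gt0 : 0 < M.
  have : 0 <= (theta * h) ^+ 2 * K by rewrite mulr_ge0 ?sqr_ge0 ?ltW.
  by rewrite /M; lra.
exists (c / M); split; first by rewrite divr_gt0.
move=> U0 U sol n; apply: le_trans (norm2_le_implicit_part _) _.
  exact: sol_selfadjoint sol n.
elim: n => [|n IH]; first by rewrite (sol_start sol) mulr0 mul0r oppr0 expR0 mul1r.
have saU := sol_selfadjoint sol n.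
have -> : - (c / M * n.+1%:R * h) = - (c / M * h) + - (c / M * n%:R * h).
  by rewrite -natr1; ring.
rewrite expRD -mulrA.
apply: le_trans (ler_wpM2l (expR_ge0 _) IH).
apply: le_trans (ler_wpM2r (sqr_ge0 _) (expR_ge1Dx _)).
apply: le_trans (theta_step_norm2 n sol) _.
rewrite [leRHS](_ : _ = sq (implicit_part (U n))
  - h * (c * (sq (implicit_part (U n)) / M))); last by ring.
have hV : sq (implicit_part (U n)) / M <= sq (U n).
  by rewrite ler_pdivrMr// mulrC implicit_part_norm2_le.
have hU := hc _ saU.
have : h * (c * (sq (implicit_part (U n)) / M)) <= h * (c * sq (U n)).
  by rewrite !ler_wpM2l// ltW.
have : h * ((1 - 2 * theta) * h * sq (alpha (U n))) <= h * ((2 * L - c) * sq (U n)).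
  by rewrite ler_wpM2l// ltW.
by lra.
Qed.

End ThetaMethod.
End Trace.
End Operators.

Unset Implicit Arguments.

Theorem theorem7 (R : realType) (H : completeNormedModType R[i])
  (dot : {dot H for (@Num.conj R[i])}) (Hdot : hilbert_inner_product dot)
  (F : set (H -> H)) (F_vna : von_neumann_algebra dot F)
  (psi : (H -> H) -> R[i]) (psi_trace : faithful_unital_normal_trace dot F psi)
  (W : R -> H -> H) (W_fbm : free_brownian_motion dot F psi W)
  (theta : R) (theta_ge0 : 0 <= theta) (theta_le1 : theta <= 1)
  (k : nat) (U0 : H -> H) (U0_sa : selfadjoint_part dot F U0)
  (alpha : (H -> H) -> H -> H) (beta gamma : 'I_k -> (H -> H) -> H -> H)
  (alpha_sa : forall U, selfadjoint_part dot F U ->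
     selfadjoint_part dot F (alpha U))
  (beta_sa : forall i U, selfadjoint_part dot F U ->
     selfadjoint_part dot F (beta i U))
  (gamma_sa : forall i U, selfadjoint_part dot F U ->
     selfadjoint_part dot F (gamma i U))
  (alpha_adapted : adapted_coefficient dot F W alpha)
  (beta_adapted : forall i, adapted_coefficient dot F W (beta i))
  (gamma_adapted : forall i, adapted_coefficient dot F W (gamma i))
  (L K : R) (L_gt0 : 0 < L) (K_gt0 : 0 < K)
  (dissipative : forall U, selfadjoint_part dot F U ->
     psi (U \o alpha U)
       + (k%:R / 2 * \sum_(i < k) norm2 dot psi (beta i U) ^+ 2
                                 * norm2 dot psi (gamma i U) ^+ 2)%:C
     <= (- L * norm2 dot psi U ^+ 2)%:C)
  (growth : forall U, selfadjoint_part dot F U ->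
     norm2 dot psi (alpha U) ^+ 2 <= K * norm2 dot psi U ^+ 2) :
  (theta < 1 / 2 ->
   forall rho : R, 0 < rho -> rho < 2 * L / ((1 - 2 * theta) * K) ->
   forall h : R, 0 < h -> h <= rho ->
   exists C : R, 0 < C /\
     forall U : nat -> H -> H,
       theta_solution dot F W alpha beta gamma theta h U0 U ->
     forall n : nat,
       norm2 dot psi (U n) ^+ 2
       <= expR (- (C * n%:R * h))
          * norm2 dot psi (U0 - (theta * h)%:C *: alpha U0) ^+ 2)
  /\
  (1 / 2 <= theta ->
   forall h : R, 0 < h ->
   exists C' : R, 0 < C' /\
     forall U : nat -> H -> H,
       theta_solution dot F W alpha beta gamma theta h U0 U ->
     forall n : nat,
       norm2 dot psi (U n) ^+ 2
       <= expR (- (C' * n%:R * h))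
          * norm2 dot psi (U0 - (theta * h)%:C *: alpha U0) ^+ 2).
Proof.
have decay (h c : R) : 0 < h -> 0 < c ->
    (forall U, selfadjoint_part dot F U ->
      (1 - 2 * theta) * h * norm2 dot psi (alpha U) ^+ 2
        <= (2 * L - c) * norm2 dot psi U ^+ 2) ->
    exists C : R, 0 < C /\
      forall U, theta_solution dot F W alpha beta gamma theta h U0 U ->
      forall n : nat, norm2 dot psi (U n) ^+ 2 <= expR (- (C * n%:R * h))
        * norm2 dot psi (U0 - (theta * h)%:C *: alpha U0) ^+ 2.
  move=> h_gt0 c_gt0 rate.
  have [C [C_gt0 hC]] := theta_exponential_decay Hdot F_vna psi_trace W_fbm
    alpha_sa beta_sa gamma_sa alpha_adapted beta_adapted gamma_adapted
    L_gt0 K_gt0 theta_ge0 h_gt0 dissipative growth c_gt0 rate.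
  by exists C; split => // U; exact: hC.
split=> [theta_lt rho rho_gt0 rho_lt h h_gt0 h_rho|theta_ge h h_gt0].
- have th : 0 < 1 - 2 * theta by lra.
  (* h <= rho < 2 L / ((1 - 2 theta) K) says that this rate is positive. *)
  apply: (decay h (2 * L - (1 - 2 * theta) * K * h)) => // [|U saU].
    rewrite subr_gt0 mulrC -ltr_pdivlMr ?mulr_gt0//.
    exact: le_lt_trans h_rho rho_lt.
  rewrite subKr [leRHS](_ : _ = (1 - 2 * theta) * h * (K * norm2 dot psi U ^+ 2)).
    by rewrite ler_wpM2l ?growth// mulr_ge0// ltW.
  by ring.
(* The quadratic drift term is nonpositive, so nothing is lost from 2 L. *)
- apply: (decay h (2 * L)) => // [|U _]; first by rewrite mulr_gt0.
  rewrite subrr mul0r -mulrA; apply: mulr_le0_ge0; first by lra.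
  by rewrite mulr_ge0 ?sqr_ge0// ltW.
Qed.
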